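(* Let $R>0$, $M>0$, $\gamma>0$. There exists $\delta_0>0$, depending only on $R$, $M$, $\gamma$, such that for every uniform Lipschitz open set $\Omega\in Lip(M,\gamma)$ in $\mathbb{R}^N$ with $\Omega\subset B(0,R)$, and every $\delta\in(0,\delta_0)$, the set $$\Omega^{\delta}=\{x\in\Omega:\ d(x,\partial\Omega)>\delta\}$$ is homotopically equivalent to $\Omega$. In particular, if $\Omega$ is connected, then $\Omega^{\delta}$ is connected for every $\delta\in(0,\delta_0)$.
   Context: $N\ge2$ is fixed; $B(0,R)$ is the open Euclidean ball of radius $R$ centred at $0$ and $d$ is Euclidean distance. Given a (Cartesian, orthonormal) coordinate system on $\mathbb{R}^N$, write $z=(\hat z,z_N)$ with $\hat z=(z_1,\dots,z_{N-1})\in\mathbb{R}^{N-1}$ and $z_N\in\mathbb{R}$. A nonempty open set $\Omega\subsetneq\mathbb{R}^N$ is called uniform Lipschitz with constants $M>0$, $\gamma>0$, written $\Omega\in Lip(M,\gamma)$, if for every $x\in\partial\Omega$ there exist a local coordinate system and a Lipschitz function $\varphi_x:U_{\hat x}\to\mathbb{R}$ with Lipschitz constant smaller than $M$ such that $$y\in O_x\cap\Omega\iff y\in O_x\ \text{ and }\ y_N>\varphi_x(\hat y),$$ where (in these coordinates) $$U_{\hat x}=\{\hat z\in\mathbb{R}^{N-1}:\ |z_i-x_i|<\gamma,\ i=1,\dots,N-1\},$$ $$O_x=\{z\in\mathbb{R}^N:\ |z_i-x_i|<\gamma,\ i=1,\dots,N-1,\ \ |z_N-x_N|<M\gamma(N-1)^{1/2}\}.$$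 *)

(* Defs.v *)
From HB Require Import structures.
From mathcomp Require Export all_boot all_order all_algebra.
From mathcomp Require Export all_classical all_reals all_analysis.

Set Implicit Arguments.
Unset Strict Implicit.
Unset Printing Implicit Defensive.

Export Order.TTheory GRing.Theory Num.Theory numFieldNormedType.Exports.

#[global] Open Scope classical_set_scope.
#[global] Open Scope ring_scope.

Definition boundary (T : topologicalType) (A : set T) : set T :=
  closure A `\` A°.

(* [homotopic f g A B] : the maps f, g, restricted to A -> B, are homotopic.
   Maps between subsets of T are represented by total functions, of which only
   the restriction (with its subspace topology) matters. *)
Definition homotopic (R : realType) (T : topologicalType) (f g : T -> T)
    (A B : set T) : Prop :=
  exists H : R * T -> T,
    [/\ {within `[0, 1]%classic `*` A, continuous H},
        forall t x, `[0, 1]%classic t -> A x -> B (H (t, x)),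
        forall x, A x -> H (0, x) = f x &
        forall x, A x -> H (1, x) = g x].

Definition homotopy_equivalent (R : realType) (T : topologicalType)
    (A B : set T) : Prop :=
  exists f g : T -> T,
    [/\ {within A, continuous f} /\ (forall x, A x -> B (f x)),
        {within B, continuous g} /\ (forall y, B y -> A (g y)),
        homotopic R (g \o f) idfun A A &
        homotopic R (f \o g) idfun B B].

(* The norm that the library puts on 'rV[R]_n is the sup norm; it induces the
   same topology, but distances, balls and Lipschitz constants below are
   Euclidean. *)
Definition enorm (R : realType) (n : nat) (x : 'rV[R]_n) : R :=
  Num.sqrt (\sum_i x 0 i ^+ 2).

Definition eball (R : realType) (n : nat) (c : 'rV[R]_n) (r : R) :
    set 'rV[R]_n :=
  [set x | enorm (x - c) < r].

(* Meaningful for nonempty A only ([inf set0] is 0). *)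
Definition edist_to (R : realType) (n : nat) (A : set 'rV[R]_n)
    (x : 'rV[R]_n) : R :=
  inf [set enorm (x - y) | y in A].

(* The space is R^N with N = n.+1, so that hat z ranges over R^(N-1) = R^n. *)
Definition hat (R : realType) (n : nat) (z : 'rV[R]_n.+1) : 'rV[R]_n :=
  \row_(i < n) z 0 (lift ord_max i).

Definition lastc (R : realType) (n : nat) (z : 'rV[R]_n.+1) : R :=
  z 0 ord_max.

(* Coordinates of z in the Cartesian system with origin a whose orthonormal
   axes are the rows of Q. *)
Definition coords (R : realType) (n : nat) (a : 'rV[R]_n) (Q : 'M[R]_n)
    (z : 'rV[R]_n) : 'rV[R]_n :=
  (z - a) *m Q^T.

(* U_hat(p) and O_p, as sets of coordinate vectors, for the point with
   coordinates p. *)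
Definition base_box (R : realType) (n : nat) (gamma : R) (p : 'rV[R]_n) :
    set 'rV[R]_n :=
  [set u | forall i, `|u 0 i - p 0 i| < gamma].

Definition local_box (R : realType) (n : nat) (M gamma : R)
    (p : 'rV[R]_n.+1) : set 'rV[R]_n.+1 :=
  [set z | base_box gamma (hat p) (hat z) /\
           `|lastc z - lastc p| < M * gamma * Num.sqrt n%:R].

Definition lipschitz_below (R : realType) (n : nat) (M : R)
    (U : set 'rV[R]_n) (phi : 'rV[R]_n -> R) : Prop :=
  exists L : R, [/\ 0 <= L, L < M &
    forall u v, U u -> U v -> `|phi u - phi v| <= L * enorm (u - v)].

Definition uniform_lipschitz (R : realType) (n : nat) (M gamma : R)
    (Omega : set 'rV[R]_n.+1) : Prop :=
  [/\ Omega !=set0, open Omega, Omega <> setT &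
    forall x, boundary Omega x ->
      exists (a : 'rV[R]_n.+1) (Q : 'M[R]_n.+1) (phi : 'rV[R]_n -> R),
        [/\ Q *m Q^T = 1%:M,
            lipschitz_below M (base_box gamma (hat (coords a Q x))) phi &
            forall y,
              let z := coords a Q y in
              let O := local_box M gamma (coords a Q x) in
              (O z /\ Omega y) <-> (O z /\ phi (hat z) < lastc z)]].

Definition inner_set (R : realType) (n : nat) (delta : R)
    (Omega : set 'rV[R]_n) : set 'rV[R]_n :=
  [set x | Omega x /\ delta < edist_to (boundary Omega) x].

(* Main.v *)
Require Import Defs.
From mathcomp Require Import finmap lra ring.

(** The set Omega is pushed into itself along straight lines, and the push
carries it into the set of points at distance more than delta from the
boundary.

Near a boundary point p, Omega is the open epigraph of a function of Lipschitz
constant less than M, so it is stable under small translations in the cone of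
aperture M around the inward axis e of the chart at p.  Translating a ball
contained in Omega by t e therefore leaves room for a larger ball: the radius
grows by t / (1 + M) ([boundary_inward]).  Gains of this kind add up when
translations along several axes are performed one after the other, and the
result of these translations does not depend on their order; hence a point x
that moves along the vector V x = sum_p lam_p e_p, a combination of the axes of
the charts near x with frozen nonnegative coefficients, gains at least
(sum_p lam_p) t / (1 + M) ([inward_sum]).  No differential equation has to be
solved: the path of x is the segment from x to x + T V x.

The boundary is compact, so finitely many charts suffice, and tent functions
make the coefficients lam_p continuous, of sum at most 1, and of sum exactly 1
near the boundary ([inward_field]).  The number of charts enters no estimate:
only the charts near x act on x, and they share a total weight of at most 1.  This
is why delta0 is uniform over all the sets Omega.  With T = (1 + M) delta the whole set Omega
is pushed into the inner set, while no point of Omega or of the inner set ever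
comes closer to the boundary; such a deformation is a homotopy equivalence and
preserves connectedness ([deformation_homotopy_equivalent]). *)

(** * The Euclidean norm *)

Section Euclidean.
Set Implicit Arguments.
Unset Strict Implicit.
Variables (R : realType) (n : nat).
Implicit Types x y : 'rV[R]_n.

Lemma enorm_ge0 x : 0 <= enorm x.
Proof. exact: sqrtr_ge0. Qed.

Lemma enorm_sqr x : enorm x ^+ 2 = \sum_i x 0 i ^+ 2.
Proof. by rewrite sqr_sqrtr// sumr_ge0// => i _; rewrite sqr_ge0. Qed.

Lemma enormE x : enorm x = Num.sqrt ((x *m x^T) 0 0).
Proof.
by congr Num.sqrt; rewrite !mxE; apply: eq_bigr => i _; rewrite mxE expr2.
Qed.

Lemma enormZ (k : R) x : enorm (k *: x) = `|k| * enorm x.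
Proof.
rewrite /enorm -sqrtr_sqr -sqrtrM ?sqr_ge0// mulr_sumr.
by congr Num.sqrt; apply: eq_bigr => i _; rewrite mxE exprMn.
Qed.

Lemma enormN x : enorm (- x) = enorm x.
Proof. by rewrite -scaleN1r enormZ normrN1 mul1r. Qed.

Lemma enorm0 : enorm (0 : 'rV[R]_n) = 0.
Proof. by rewrite -(scale0r 0) enormZ normr0 mul0r. Qed.

Lemma enormB x y : enorm (x - y) = enorm (y - x).
Proof. by rewrite -enormN opprB. Qed.

Lemma coord_le_enorm x i : `|x 0 i| <= enorm x.
Proof.
rewrite -sqrtr_sqr ler_sqrt ?sumr_ge0// => [|j _]; last exact: sqr_ge0.
by rewrite (bigD1 i)//= lerDl sumr_ge0// => j _; rewrite sqr_ge0.
Qed.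

Lemma enorm_eq0 x : enorm x = 0 -> x = 0.
Proof.
move=> x0; apply/rowP => i; rewrite mxE; apply/eqP.
by rewrite -normr_le0 -x0 coord_le_enorm.
Qed.

(** Expanding the sum of the squares of x_i |y| - y_i |x| gives
2 |x| |y| (|x| |y| - <x, y>). *)
Lemma cauchy_schwarz x y : \sum_i x 0 i * y 0 i <= enorm x * enorm y.
Proof.
have [x0|x0] := eqVneq (enorm x) 0.
  rewrite x0 mul0r (enorm_eq0 x0) big1// => i _; by rewrite mxE mul0r.
have [y0|y0] := eqVneq (enorm y) 0.
  rewrite y0 mulr0 (enorm_eq0 y0) big1// => i _; by rewrite mxE mulr0.
have xp : 0 < enorm x by rewrite lt_def x0 enorm_ge0.
have yp : 0 < enorm y by rewrite lt_def y0 enorm_ge0.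
have : 0 <= \sum_i (x 0 i * enorm y - y 0 i * enorm x) ^+ 2.
  by apply: sumr_ge0 => i _; rewrite sqr_ge0.
have -> : \sum_i (x 0 i * enorm y - y 0 i * enorm x) ^+ 2 =
    2 * (enorm x * enorm y) *
      (enorm x * enorm y - \sum_i x 0 i * y 0 i).
  transitivity (enorm y ^+ 2 * (\sum_i x 0 i ^+ 2) +
      enorm x ^+ 2 * (\sum_i y 0 i ^+ 2) -
      2 * (enorm x * enorm y) * \sum_i x 0 i * y 0 i).
    rewrite !mulr_sumr -big_split -sumrB/=; apply: eq_bigr => i _; ring.
  by rewrite -!enorm_sqr; ring.
by rewrite pmulr_rge0 ?subr_ge0// mulr_gt0// mulr_gt0.
Qed.

Lemma enormD x y : enorm (x + y) <= enorm x + enorm y.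
Proof.
rewrite -(@ler_pXn2r _ 2)// ?nnegrE ?addr_ge0 ?enorm_ge0//.
rewrite sqrrD !enorm_sqr.
have -> : \sum_i (x + y) 0 i ^+ 2 =
    \sum_i x 0 i ^+ 2 + (\sum_i x 0 i * y 0 i) *+ 2 + \sum_i y 0 i ^+ 2.
  rewrite -sumrMnl -!big_split/=; apply: eq_bigr => i _.
  by rewrite mxE sqrrD.
by rewrite lerD2r lerD2l lerMn2r/= cauchy_schwarz.
Qed.

Lemma enorm_orthogonal (Q : 'M[R]_n) x :
  Q *m Q^T = 1%:M -> enorm (x *m Q^T) = enorm x.
Proof.
move=> /mulmx1C QQ; rewrite !enormE trmx_mul trmxK mulmxA.
by rewrite -(mulmxA x) QQ mulmx1.
Qed.

Lemma mx_norm_le_enorm x : `|x| <= enorm x.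
Proof.
rewrite /Num.norm/= mx_normrE; apply/bigmax_leP; split=> [|[i j] _/=].
  exact: enorm_ge0.
by rewrite (ord1 i) coord_le_enorm.
Qed.

Lemma continuous_sumr (T : topologicalType) (V : normedModType R) (I : Type)
    (s : seq I) (F : I -> T -> V) :
  (forall i, continuous (F i)) -> continuous (fun t => \sum_(i <- s) F i t).
Proof.
move=> Fc; apply: (@continuous_big V I +%R 0 xpredT) => [|i _]; last exact: Fc.
exact: add_continuous.
Qed.

Lemma enorm_continuous : continuous (@enorm R n).
Proof.
move=> x; apply: continuous_comp; last exact: sqrt_continuous.
apply: (@continuous_sumr _ R^o) => i {}x.
apply: continuous_comp (@exprn_continuous _ 2 _).
exact: coord_continuous.
Qed.

End Euclidean.

(** * Balls inside a set and distance to its boundary *)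

Section Distance.
Set Implicit Arguments.
Unset Strict Implicit.
Variables (R : realType) (n : nat).
Implicit Types (x y e : 'rV[R]_n) (A B : set 'rV[R]_n).

Lemma enormB_continuous x : continuous (fun y => enorm (y - x)).
Proof.
move=> y.
apply: (@continuous_comp 'rV[R]_n 'rV[R]_n R (fun z => z - x) (@enorm R n)).
  by apply: continuousB => //; exact: cst_continuous.
exact: enorm_continuous.
Qed.

Lemma eball_open x (r : R) : open (eball x r).
Proof.
rewrite (_ : eball x r = (fun y => enorm (y - x)) @^-1` [set t | t < r])//.
by apply: open_comp => [y _|]; [exact: enormB_continuous | exact: open_lt].
Qed.

Lemma eball_center x (r : R) : 0 < r -> eball x r x.
Proof. by rewrite /eball/= subrr enorm0. Qed.

Lemma open_eball A x : open A -> A x ->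
  exists2 r : R, 0 < r & eball x r `<=` A.
Proof.
move=> oA Ax; have /nbhs_ballP[r /= r0 rA] : nbhs x A by exact: open_nbhs_nbhs.
exists r => // y yr; apply: rA.
rewrite mx_norm_ball /ball_/= distrC.
by rewrite (le_lt_trans (mx_norm_le_enorm _)).
Qed.

Lemma boundaryN A x : open A -> boundary A x -> ~ A x.
Proof. by move=> oA [_ nA] Ax; apply: nA; exact: open_nbhs_nbhs. Qed.

(** Off its boundary, a set is both open and closed: its interior and its closure
agree there. *)
Lemma connected_boundary (T : topologicalType) (A B : set T) :
  connected B -> B `&` A !=set0 -> ~ B `<=` A -> B `&` boundary A !=set0.
Proof.
move=> cB BA nBA; apply: contrapT => /forallNP nb; apply: nBA.
have clA z : B z -> closure A z -> A° z.
  by move=> Bz cz; apply: contrapT => iz; apply: (nb z).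
suff <- : B `&` A = B by exact: subIsetr.
apply: cB => //.
- exists (A°); first exact: open_interior.
  apply/seteqP; split=> z [Bz Az]; split=> //; last exact: interior_subset.
  by apply: clA => //; exact: subset_closure.
- exists (closure A); first exact: closed_closure.
  apply/seteqP; split=> z [Bz Az]; split=> //; first exact: subset_closure.
  by apply: interior_subset; exact: clA.
Qed.

Lemma segment_image_connected (T : topologicalType) (f : R -> T) :
  continuous f -> connected (f @` `[0, 1]).
Proof.
move=> fc; apply: connected_continuous_connected.
  exact: segment_connected.
exact: continuous_subspaceT.
Qed.

Lemma line_continuous x v : continuous (fun t : R => x + t *: v).
Proof.
move=> t; apply: cvgD; first exact: cvg_cst.
apply: cvgZr_tmp; exact: cvg_id.
Qed.

Lemma segment_boundary A x y : A x -> ~ A y ->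
  exists2 t : R, 0 <= t <= 1 & boundary A (x + t *: (y - x)).
Proof.
move=> Ax nAy.
have [|||z [[t]]] := @connected_boundary _ A ((fun t : R => x + t *: (y - x)) @` `[0, 1]).
- exact/segment_image_connected/line_continuous.
- exists x; split=> //; exists 0; last by rewrite scale0r addr0.
  by rewrite /= in_itv/= lexx ler01.
- move/(_ y); apply/not_implyP; split=> //; exists 1.
    by rewrite /= in_itv/= lexx ler01.
  by rewrite scale1r addrC subrK.
by rewrite /= in_itv/= => t01 zE; rewrite -zE => bt; exists t.
Qed.

Lemma edist_to_le A x y : A y -> edist_to A x <= enorm (x - y).
Proof.
move=> Ay; apply: ge_inf; last by exists y.
by exists 0 => _ [z _ <-]; exact: enorm_ge0.
Qed.

Lemma edist_to_lt A x (r : R) : A !=set0 -> edist_to A x < r ->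
  exists2 y, A y & enorm (x - y) < r.
Proof.
move=> [a Aa] xr.
have [||_ [y Ay <-] yr] :=
  @inf_adherent _ [set enorm (x - y) | y in A] (r - edist_to A x).
- by rewrite subr_gt0.
- split; first by exists (enorm (x - a)), a.
  by exists 0 => _ [z _ <-]; exact: enorm_ge0.
- by exists y => //; move: yr; rewrite /edist_to subrKC.
Qed.

(** Together with [edist_eball_sub], this turns lower bounds on the distance to the
boundary into inclusions of balls, which are easier to translate. *)
Lemma eball_sub_edist A x (r : R) : open A -> boundary A !=set0 ->
  eball x r `<=` A -> r <= edist_to (boundary A) x.
Proof.
move=> oA bA rA; rewrite leNgt; apply/negP => /(edist_to_lt bA)[y by_].
rewrite enormB => yr.
exact: (boundaryN oA by_ (rA y yr)).
Qed.

(** A point of the ball outside A would force the segment from x to it to cross the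
boundary at distance less than r. *)
Lemma edist_eball_sub A x (r : R) :
  A x -> r <= edist_to (boundary A) x -> eball x r `<=` A.
Proof.
move=> Ax rd y yr; apply: contrapT => /(segment_boundary Ax)[t /andP[t0 t1]].
move=> /(@edist_to_le _ x); rewrite opprD addNKr enormN enormZ ger0_norm//.
move=> dt; move: yr; rewrite /eball/= ltNge => /negP; apply.
by rewrite (le_trans rd)// (le_trans dt)// ler_piMl// enorm_ge0.
Qed.

Lemma boundary_nonempty A : A !=set0 -> A <> setT -> boundary A !=set0.
Proof.
move=> [x Ax] /eqP AT; have [y nAy] : exists y, ~ A y.
  by apply/existsNP => Aall; case/eqP: AT; apply/seteqP; split.
by have [t _ bt] := segment_boundary Ax nAy; eexists; exact: bt.
Qed.

End Distance.

(** * Gaining room by moving along the axis of a chart *)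

Section Push.
Set Implicit Arguments.
Unset Strict Implicit.
Variables (R : realType) (n : nat).
Implicit Types (x y e : 'rV[R]_n.+1) (A : set 'rV[R]_n.+1).

Lemma hatE x i : hat x 0 i = x 0 (lift ord_max i).
Proof. by rewrite mxE. Qed.

Lemma enorm_hat_le x : enorm (hat x) <= enorm x.
Proof.
rewrite ler_sqrt; last by apply: sumr_ge0 => i _; rewrite sqr_ge0.
rewrite [leRHS](bigD1_ord ord_max)//=.
under eq_bigr do rewrite hatE.
by rewrite lerDr sqr_ge0.
Qed.

Lemma hatD x y : hat (x + y) = hat x + hat y.
Proof. by apply/rowP => i; rewrite !mxE. Qed.

Lemma lastcD x y : lastc (x + y) = lastc x + lastc y.
Proof. by rewrite /lastc mxE. Qed.

Lemma coordsD (a : 'rV[R]_n.+1) Q x y :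
  coords a Q (x + y) = coords a Q x + y *m Q^T.
Proof. by rewrite /coords addrAC mulmxDl. Qed.

Lemma coordsB (a : 'rV[R]_n.+1) Q x y :
  coords a Q x - coords a Q y = (x - y) *m Q^T.
Proof. by rewrite /coords -mulmxBl opprB addrA subrK. Qed.

(** The box has half-height M gamma sqrt n, where sqrt n >= 1, so it contains the
Euclidean ball of radius min(gamma, M gamma). *)
Lemma coords_local_box (M gamma r : R) (a x y : 'rV[R]_n.+1) Q :
  (0 < n)%N -> 0 < M -> 0 < gamma -> r <= gamma -> r <= M * gamma ->
  Q *m Q^T = 1%:M -> enorm (y - x) < r ->
  local_box M gamma (coords a Q x) (coords a Q y).
Proof.
move=> n0 M0 g0 rg rMg QQ yxr.
have coord_lt i : `|coords a Q y 0 i - coords a Q x 0 i| < r.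
  have -> : coords a Q y 0 i - coords a Q x 0 i = ((y - x) *m Q^T) 0 i.
    by rewrite -(coordsB a) !mxE.
  by rewrite (le_lt_trans (coord_le_enorm _ _))// enorm_orthogonal.
split=> [i|]; first by rewrite !hatE (lt_le_trans (coord_lt _)).
rewrite (lt_le_trans (coord_lt _))// (le_trans rMg)//.
rewrite ler_peMr ?mulr_ge0 ?(ltW M0) ?(ltW g0)//.
by rewrite -[leLHS]sqrtr1 ler_sqrt ?ler0n// ler1n.
Qed.

(** If |u| <= t / (1 + M), the vector t e + u lies in the cone of aperture M around
e: its height is at least t - |u| >= M |u|, and its horizontal part is that of u.
Moving along it raises the graph by at most M |u|, so the point stays above. *)
Lemma lipschitz_cone (M gamma r : R) A x0 :
  (0 < n)%N -> 0 < M -> 0 < gamma -> r <= gamma -> r <= M * gamma ->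
  uniform_lipschitz M gamma A -> boundary A x0 ->
  exists2 e, enorm e = 1 & forall y t u, A y -> (1 + M) * enorm u <= t ->
    enorm (y - x0) < r -> enorm (y + (t *: e + u) - x0) < r ->
    A (y + (t *: e + u)).
Proof.
move=> n0 M0 g0 rg rMg [_ _ _ /[apply]] [a [Q [phi [QQ [L [L0 LM phiL]] chart]]]].
pose e : 'rV[R]_n.+1 := row ord_max Q.
have eQ : e *m Q^T = row ord_max 1%:M by rewrite -row_mul QQ.
have eQE i : (e *m Q^T) 0 i = (ord_max == i)%:R by rewrite eQ !mxE.
exists e => [|y t u Ay ut yr yur].
  rewrite -(enorm_orthogonal _ QQ) /enorm (bigD1 ord_max)//= big1 => [|i iN].
    by rewrite eQE eqxx expr1n addr0 sqrtr1.
  by rewrite eQE eq_sym (negbTE iN) expr0n.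
have yb : local_box M gamma (coords a Q x0) (coords a Q y).
  exact: coords_local_box yr.
have yub : local_box M gamma (coords a Q x0) (coords a Q (y + (t *: e + u))).
  exact: coords_local_box yur.
have /chart[_ phiy] : local_box M gamma (coords a Q x0) (coords a Q y) /\ A y by [].
suff /chart[] : local_box M gamma (coords a Q x0) (coords a Q (y + (t *: e + u))) /\
  phi (hat (coords a Q (y + (t *: e + u)))) < lastc (coords a Q (y + (t *: e + u))) by [].
split=> //.
have hatyu : hat (coords a Q (y + (t *: e + u))) = hat (coords a Q y) + hat (u *m Q^T).
  rewrite coordsD mulmxDl -scalemxAl !hatD.
  have -> : hat (t *: (e *m Q^T)) = 0.
    by apply/rowP => i; rewrite hatE mxE eQE (negbTE (neq_lift _ _)) mulr0 mxE.
  by rewrite add0r.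
have lastyu : lastc (coords a Q (y + (t *: e + u))) =
    lastc (coords a Q y) + (t + lastc (u *m Q^T)).
  rewrite coordsD mulmxDl -scalemxAl !lastcD; congr (_ + (_ + _)).
  by rewrite /lastc mxE eQE eqxx mulr1.
have := phiL _ _ yub.1 yb.1.
rewrite hatyu lastyu addrAC subrr add0r => /(le_trans (ler_norm _)) phiyu.
have hu : enorm (hat (u *m Q^T)) <= enorm u.
  by rewrite (le_trans (enorm_hat_le _))// enorm_orthogonal.
have lu : `|lastc (u *m Q^T)| <= enorm u.
  by rewrite (le_trans (coord_le_enorm _ _))// enorm_orthogonal.
have : - enorm u <= lastc (u *m Q^T).
  by rewrite lerNl (le_trans _ lu)// -normrN ler_norm.
have : L * enorm (hat (u *m Q^T)) <= M * enorm u.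
  by rewrite ler_pM ?enorm_ge0// ltW.
by move: phiy phiyu ut; lra.
Qed.

(** The direction e is inward near x0 at rate c.  The rate is expressed with balls
inside A rather than with the distance to the boundary, so that gains along
different directions can be chained; the condition involving r keeps the final
ball, and the translation leading to it, inside the ball of radius r at x0. *)
Definition inward (c r : R) A x0 e := forall y s t, 0 < s -> 0 <= t ->
  enorm (y - x0) + s + (1 + c) * t <= r -> eball y s `<=` A ->
  eball (y + t *: e) (s + c * t) `<=` A.

(** Write a point of the large ball as y + t e + w with |w| < s + c t, and cut w into
two collinear parts, of norm less than s and at most c t.  The first is absorbed by
the ball at y, the second by the cone of [lipschitz_cone]. *)
Lemma boundary_inward (M gamma r : R) A x0 :
  (0 < n)%N -> 0 < M -> 0 < gamma -> r <= gamma -> r <= M * gamma ->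
  uniform_lipschitz M gamma A -> boundary A x0 ->
  exists2 e, enorm e = 1 & inward (1 + M)^-1 r A x0 e.
Proof.
move=> n0 M0 g0 rg rMg UL bx0.
have [e e1 cone] := lipschitz_cone n0 M0 g0 rg rMg UL bx0.
exists e => // y s t s0 t0; set c := (1 + M)^-1 => ysr yA p pst.
have M1 : 0 < 1 + M by lra.
have c0 : 0 < c by rewrite invr_gt0.
have ct0 : 0 <= c * t by rewrite mulr_ge0// ltW.
have d0 : 0 < s + c * t by rewrite ltr_pwDl.
set w := p - (y + t *: e) in pst *.
pose k := (s + c * t)^-1.
have k0 : 0 < k by rewrite invr_gt0.
have ksct : k * s + k * (c * t) = 1 by rewrite -mulrDr mulVf// gt_eqF.
have wk : k * enorm w < 1.
  by rewrite mulrC ltr_pdivrMr// mul1r.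
have u'lt : enorm ((k * s) *: w) < s.
  rewrite enormZ ger0_norm ?mulr_ge0 ?ltW// mulrAC gtr_pMl//.
have u''le : enorm ((k * (c * t)) *: w) <= c * t.
  rewrite enormZ ger0_norm ?(mulr_ge0 (ltW k0))// mulrAC ler_piMl//.
  exact: ltW.
have wE : w = (k * s) *: w + (k * (c * t)) *: w by rewrite -scalerDl ksct scale1r.
have pE : p = y + (k * s) *: w + (t *: e + (k * (c * t)) *: w).
  by rewrite addrACA -wE addrC subrK.
have tr1 : enorm (y + (k * s) *: w - x0) < enorm (y - x0) + s.
  by rewrite addrAC (le_lt_trans (enormD _ _))// ltrD2l.
have tr2 : enorm (t *: e + (k * (c * t)) *: w) <= t + c * t.
  rewrite (le_trans (enormD _ _))// lerD// enormZ e1 mulr1 ger0_norm//.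
have sum : enorm (y - x0) + s + (t + c * t) <= r by move: ysr; lra.
rewrite pE; apply: cone => //.
- by apply: yA; rewrite /eball/= addrAC subrr add0r.
- by rewrite [leLHS]mulrC -ler_pdivlMr// [leRHS]mulrC.
- rewrite (lt_le_trans tr1)// (le_trans _ sum)// lerDl addr_ge0//.
- rewrite addrAC (le_lt_trans (enormD _ _))// (lt_le_trans _ sum)//.
  by move: tr1 tr2; lra.
Qed.

(** One direction is followed at a time, and the gains accumulate.  The condition
with the factor 2 accounts for the intermediate positions: the point has moved by at
most the total weight, and since c <= 1 its ball has grown by at most as much. *)
Lemma inward_sum (c r : R) A (I : Type) (ps : seq I) (p e : I -> 'rV[R]_n.+1)
    (l : I -> R) x s :
  0 < c -> c <= 1 -> 0 < s ->
  (forall i, 0 <= l i) -> (forall i, enorm (e i) = 1) ->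
  (forall i, 0 < l i -> inward c r A (p i) (e i)) ->
  (forall i, 0 < l i -> enorm (x - p i) + s + 2 * \sum_(j <- ps) l j <= r) ->
  eball x s `<=` A ->
  eball (x + \sum_(i <- ps) l i *: e i) (s + c * \sum_(i <- ps) l i) `<=` A.
Proof.
move=> c0 c1 s0 l0 e1 inw.
have en (qs : seq I) : enorm (\sum_(i <- qs) l i *: e i) <= \sum_(i <- qs) l i.
  elim: qs => [|i qs IH]; first by rewrite !big_nil enorm0.
  rewrite !big_cons (le_trans (enormD _ _))// lerD//.
  by rewrite enormZ e1 mulr1 ger0_norm.
elim: ps => [|i ps IH] near xA; first by rewrite !big_nil addr0 mulr0 addr0.
have S0 : 0 <= \sum_(j <- ps) l j by apply: sumr_ge0.
have {}IH := IH _ xA.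
rewrite !big_cons.
have [li0|li0] := leP (l i) 0.
  have -> : l i = 0 by apply/eqP; rewrite eq_le li0 l0.
  rewrite scale0r !add0r; apply: IH => j lj.
  rewrite (le_trans _ (near j lj))// big_cons.
  by have := l0 i; lra.
have -> : x + (l i *: e i + \sum_(j <- ps) l j *: e j) =
    x + \sum_(j <- ps) l j *: e j + l i *: e i by rewrite addrA addrAC.
have -> : s + c * (l i + \sum_(j <- ps) l j) =
    s + c * (\sum_(j <- ps) l j) + c * l i by ring.
apply: inw => //.
- by rewrite ltr_pwDl// mulr_ge0// ltW.
- have /= := near i li0; rewrite big_cons.
  have := enormD (x - p i) (\sum_(i <- ps) l i *: e i).
  have := en ps; rewrite addrAC.
  have : c * (\sum_(j <- ps) l j) <= \sum_(j <- ps) l j by rewrite ler_piMl.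
  have : c * l i <= l i by rewrite ler_piMl.
  by lra.
- apply: IH => j lj; rewrite (le_trans _ (near j lj))// big_cons.
  by have := l0 i; lra.
Qed.

End Push.

(** * Deformations into a subset *)

Section Deformation.
Set Implicit Arguments.
Unset Strict Implicit.

Lemma continuous_pair (T U V : topologicalType) (f : T -> U) (g : T -> V) :
  continuous f -> continuous g -> continuous (fun t => (f t, g t)).
Proof.
by move=> fc gc t; apply: (@cvg_pair _ _ _ _ (nbhs (f t)) (nbhs (g t)));
  [exact: fc | exact: gc].
Qed.

(** The inclusion of B and the final map G(1, -) are inverse up to homotopy, both
homotopies being G run backwards.  For connectedness, B is the union of the image
of A under G(1, -) and of the paths of the points of B, and every such path ends in
that image. *)
Lemma deformation_homotopy_equivalent (R : realType) (T : topologicalType)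
    (A B : set T) (G : R * T -> T) :
  continuous G -> B `<=` A -> (forall x, G (0, x) = x) ->
  (forall t x, 0 <= t <= 1 -> A x -> A (G (t, x))) ->
  (forall t x, 0 <= t <= 1 -> B x -> B (G (t, x))) ->
  (forall x, A x -> B (G (1, x))) ->
  homotopy_equivalent R B A /\ (connected A -> connected B).
Proof.
move=> Gc BA G0 GA GB G1.
have Gtc x : continuous (fun t => G (t, x)).
  move=> t; apply: (@continuous_comp R (R * T)%type T (fun t => (t, x)) G).
    by apply: continuous_pair => s; [exact: cvg_id | exact: cvg_cst].
  exact: Gc.
have Gxc t : continuous (fun x => G (t, x)).
  move=> x; apply: (@continuous_comp T (R * T)%type T (fun x => (t, x)) G).
    by apply: continuous_pair => s; [exact: cvg_cst | exact: cvg_id].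
  exact: Gc.
pose H (p : R * T) := G (1 - p.1, p.2).
have Hc : continuous H.
  move=> p; apply: (@continuous_comp _ (R * T)%type T
    (fun p : R * T => (1 - p.1, p.2)) G); last exact: Gc.
  apply: continuous_pair => q; last exact: cvg_snd.
  by apply: cvgB; [exact: cvg_cst | exact: cvg_fst].
have sub01 (t : R) : `[0, 1]%classic t -> 0 <= 1 - t <= 1.
  rewrite /= in_itv/=; lra.
split.
  exists id, (fun x => G (1, x)); split.
  - by split=> //; apply: continuous_subspaceT => x; exact: cvg_id.
  - by split=> //; apply: continuous_subspaceT.
  - exists H; split=> [|t x /sub01 t01 Bx|x Bx|x Bx].
    + exact: continuous_subspaceT.
    + exact: GB.
    + by rewrite /H/= subr0.
    + by rewrite /H/= subrr G0.
  - exists H; split=> [|t x /sub01 t01 Ax|x Ax|x Ax].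
    + exact: continuous_subspaceT.
    + exact: GA.
    + by rewrite /H/= subr0.
    + by rewrite /H/= subrr G0.
move=> cA; have [->|/set0P[a Ba]] := eqVneq B set0; first exact: connected0.
have -> : B = \bigcup_(x in B)
    ((fun y => G (1, y)) @` A `|` (fun t => G (t, x)) @` `[0, 1]).
  apply/seteqP; split=> [x Bx|y [x Bx [[z Az <-]|[t t01 <-]]]].
  - exists x => //; right; exists 0; last exact: G0.
    by rewrite /= in_itv/= lexx ler01.
  - exact: G1.
  - by apply: GB => //; move: t01; rewrite /= in_itv.
apply: bigcup_connected.
  by exists (G (1, a)) => x Bx; left; exists a => //; exact: BA.
move=> x Bx; apply: connectedU.
- exists (G (1, x)); split; first by exists x => //; exact: BA.
  by exists 1 => //; rewrite /= in_itv/= lexx ler01.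
- by apply: connected_continuous_connected => //; exact: continuous_subspaceT.
- exact: segment_image_connected.
Qed.

End Deformation.

(** * A global inward field *)

Section Field.
Set Implicit Arguments.
Unset Strict Implicit.
Variables (R : realType) (n : nat).
Implicit Types (x y : 'rV[R]_n.+1) (A : set 'rV[R]_n.+1).

Lemma boundary_compact A (rho : R) : A `<=` eball 0 rho -> compact (boundary A).
Proof.
move=> Arho; apply: bounded_closed_compact.
  suff cl : closure A `<=` [set x | enorm x <= rho].
    exists rho; split; first exact: num_real.
    move=> m rm x [/cl/= xr _]; apply: le_trans (mx_norm_le_enorm _) _.
    exact: le_trans xr (ltW rm).
  rewrite -[X in _ `<=` X](_ : closure [set x | enorm x <= rho] = _).
    apply: closureS => x /Arho; rewrite /eball/= subr0; exact: ltW.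
  apply/esym/closure_id.
  apply: (@closed_comp _ _ (@enorm R n.+1) [set t | t <= rho]).
    by move=> x _; exact: enorm_continuous.
  exact: closed_le.
by apply: closedI; [exact: closed_closure | exact: open_closedC (open_interior _)].
Qed.

Lemma eball_sub x (s s' : R) : s <= s' -> eball x s `<=` eball x s'.
Proof. by move=> ss' y /= /lt_le_trans; apply. Qed.

(** The constants fit together as follows.  A chart p acts on the points at distance
less than r / 4; if y is a boundary point at distance less than r / 8 of x, and p is
a center of the cover with |y - p| < r / 16, then |x - p| < 3 r / 16, so the tent
function of p is at least r / 16 at x.  A ball around x inside A misses p, so its
radius is less than r / 4 when p acts on x; this and T <= r / 8 bound the quantity
in [inward_sum] by r / 4 + r / 4 + 2 r / 8 <= r. *)
Lemma inward_field (c r : R) A :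
  0 < c -> c <= 1 -> 0 < r -> open A -> compact (boundary A) ->
  boundary A !=set0 ->
  (forall p, boundary A p -> exists2 e, enorm e = 1 & inward c r A p e) ->
  exists2 V : 'rV[R]_n.+1 -> 'rV[R]_n.+1, continuous V &
    forall T x s, 0 <= T -> T <= r / 8 -> 0 < s -> eball x s `<=` A ->
      eball (x + T *: V x) s `<=` A /\
      ((exists2 y, boundary A y & enorm (x - y) < r / 8) ->
        eball (x + T *: V x) (s + c * T) `<=` A).
Proof.
move=> c0 c1 r0 oA cbA [b0 bb0] inw.
have /choice[e eP] : forall p, exists e : 'rV[R]_n.+1,
    enorm e = 1 /\ (boundary A p -> inward c r A p e).
  (* Off the boundary only the norm of e p matters, and b0 supplies a unit vector. *)
  move=> p; have [/inw[e e1 ie]|np] := pselect (boundary A p); first by exists e.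
  by have [e e1 _] := inw _ bb0; exists e.
have r16 : 0 < r / 16 by lra.
move: cbA; rewrite compact_cover => /(_ _ (boundary A) (fun p => eball p (r / 16))).
case=> [p _|p bp|D Db covD]; first exact: eball_open.
  by exists p => //; exact: eball_center.
pose ps : seq 'rV[R]_n.+1 := enum_fset D.
pose bump p x : R := Num.max 0 (r / 4 - enorm (x - p)).
(* The maximum with r / 16 keeps the denominator positive and is inactive near the
   boundary, where the weights have to sum to 1. *)
pose tot x : R := Num.max (r / 16) (\sum_(p <- ps) bump p x).
(* The test p \in ps lets a positive weight imply that p is a boundary point. *)
pose lam p x := if p \in ps then bump p x / tot x else 0.
have bump0 p x : 0 <= bump p x by rewrite le_max lexx.
have tot_gt0 x : 0 < tot x by rewrite lt_max r16.
have lam0 p x : 0 <= lam p x.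
  by rewrite /lam; case: ifP => // _; rewrite divr_ge0// ltW.
have sumlam x : \sum_(p <- ps) lam p x = (\sum_(p <- ps) bump p x) / tot x.
  by rewrite mulr_suml; apply: eq_big_seq => p pps; rewrite /lam pps.
have maxc (a : R) (f : 'rV[R]_n.+1 -> R) :
    continuous f -> continuous (fun x => Num.max a (f x)).
  move=> fc x; apply: (@continuous_max R _ (fun=> a) f); last exact: fc.
  exact: cst_continuous.
have bumpc p : continuous (bump p).
  apply: maxc => x; apply: (@continuousB R R^o 'rV[R]_n.+1 (fun=> r / 4)
    (fun y => enorm (y - p))).
    exact: cst_continuous.
  exact: enormB_continuous.
have totc : continuous tot by apply: maxc; apply: (@continuous_sumr _ _ R^o).
have lamc p : continuous (lam p).
  move=> x; rewrite /lam; case: (p \in ps); last exact: cst_continuous.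
  apply: (@continuousM R 'rV[R]_n.+1 (bump p) (fun x => (tot x)^-1)).
    exact: bumpc.
  by apply: continuousV; [rewrite gt_eqF | exact: totc].
exists (fun x => \sum_(p <- ps) lam p x *: e p).
  by apply: continuous_sumr => p x; apply: continuousZr_tmp; exact: lamc.
move=> T x s T0 Tr s0 xA.
have lamle1 : \sum_(p <- ps) lam p x <= 1.
  by rewrite sumlam ler_pdivrMr// mul1r le_max lexx orbT.
have lam_near p : 0 < lam p x -> boundary A p /\ enorm (x - p) < r / 4.
  rewrite /lam; case: ifP => [pps|]; last by rewrite ltxx.
  rewrite pmulr_lgt0 ?invr_gt0// /bump lt_max ltxx/= subr_gt0; split=> //.
  by have := Db p pps; rewrite in_setE.
have push : eball (x + T *: \sum_(p <- ps) lam p x *: e p)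
    (s + c * (T * \sum_(p <- ps) lam p x)) `<=` A.
  rewrite scaler_sumr mulr_sumr; under eq_bigr do rewrite scalerA.
  apply: (@inward_sum _ _ c r A _ ps id e) => //.
  - by move=> p; rewrite mulr_ge0.
  - by move=> p; exact: (eP p).1.
  - move=> p Tl; apply: (eP p).2; apply: (lam_near p _).1.
    by rewrite lt_def lam0 andbT; apply/eqP => l0; move: Tl; rewrite l0 mulr0 ltxx.
  - move=> p Tl; have [bp xp] : boundary A p /\ enorm (x - p) < r / 4.
      apply: lam_near.
      by rewrite lt_def lam0 andbT; apply/eqP => l0; move: Tl; rewrite l0 mulr0 ltxx.
    have sxp : s <= enorm (x - p).
      rewrite leNgt; apply/negP => xps; apply: (boundaryN oA bp); apply: xA.
      by rewrite /eball/= enormB.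
    have : T * \sum_(p <- ps) lam p x <= T by rewrite ler_piMr.
    rewrite -mulr_sumr; move: sxp xp Tr; lra.
split.
  apply: subset_trans push; apply: eball_sub.
  by rewrite lerDl mulr_ge0 ?(ltW c0)// mulr_ge0// sumr_ge0.
move=> [y by_ xy]; apply: subset_trans push; apply: eball_sub.
suff -> : \sum_(p <- ps) lam p x = 1 by rewrite mulr1.
have [p pps /= yp] := covD y by_.
have bp : r / 16 <= bump p x.
  rewrite le_max; apply/orP; right.
  have := enormD (x - y) (y - p); rewrite addrA subrK.
  move: yp; rewrite /eball/=; lra.
have bump_tot : bump p x <= \sum_(q <- ps) bump q x.
  by rewrite (big_rem p)//= lerDl sumr_ge0.
have totE : tot x = \sum_(q <- ps) bump q x.
  by apply/max_idPr; exact: le_trans bump_tot.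
by rewrite sumlam -totE divff// gt_eqF.
Qed.

End Field.

(** * The inner sets of a uniform Lipschitz open set *)

Theorem proposition4p3 (R : realType) (n : nat) (hn : (2 <= n.+1)%N)
    (rho M gamma : R) (hrho : 0 < rho) (hM : 0 < M) (hgamma : 0 < gamma) :
  exists delta0 : R, 0 < delta0 /\
    forall Omega : set 'rV[R]_n.+1,
      uniform_lipschitz M gamma Omega ->
      Omega `<=` eball 0 rho ->
      forall delta : R, 0 < delta -> delta < delta0 ->
        homotopy_equivalent R (inner_set delta Omega) Omega /\
        (connected Omega -> connected (inner_set delta Omega)).
Proof.
pose r := Num.min gamma (M * gamma).
have r0 : 0 < r by rewrite lt_min hgamma mulr_gt0.
have rg : r <= gamma by rewrite ge_min lexx.
have rMg : r <= M * gamma by rewrite ge_min lexx orbT.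
have M1 : 0 < 1 + M by lra.
exists (r / 8 / (1 + M)); split=> [|Omega UL Orho delta d0 dlt].
  by rewrite !divr_gt0.
have [One oO OT _] := UL.
have bO : boundary Omega !=set0 by exact: boundary_nonempty One OT.
pose c := (1 + M)^-1.
have c0 : 0 < c by rewrite invr_gt0.
have c1 : c <= 1 by rewrite invf_le1//; lra.
pose T := (1 + M) * delta.
have T0 : 0 < T by rewrite mulr_gt0.
have Tr : T <= r / 8 by rewrite ltW// /T mulrC -ltr_pdivlMr.
have cT : c * T = delta by rewrite mulKf// gt_eqF.
have [V Vc push] := inward_field c0 c1 r0 oO (boundary_compact Orho) bO
  (fun p => boundary_inward hn hM hgamma rg rMg UL).
pose G (p : R * 'rV[R]_n.+1) := p.2 + (p.1 * T) *: V p.2.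
have pushG t x s : 0 <= t <= 1 -> 0 < s -> eball x s `<=` Omega ->
    eball (G (t, x)) s `<=` Omega.
  move=> /andP[t0 t1] s0 xs; apply: (push _ _ _ _ _ s0 xs).1.
    by rewrite mulr_ge0// ltW.
  by rewrite (le_trans _ Tr)// ler_piMl// ltW.
apply: (@deformation_homotopy_equivalent _ _ _ _ G).
- move=> p; apply: cvgD; first exact: cvg_snd.
  apply: cvgZ; first by apply: cvgM; [exact: cvg_fst | exact: cvg_cst].
  apply: (@continuous_comp _ 'rV[R]_n.+1 'rV[R]_n.+1 snd V); first exact: cvg_snd.
  exact: Vc.
- by move=> x [].
- by move=> x; rewrite /G/= mul0r scale0r addr0.
- move=> t x t01 /(open_eball oO)[s s0 xs].
  by apply: (pushG _ _ _ t01 s0 xs); exact: eball_center.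
- move=> t x t01 [Ox dx].
  have dx0 : 0 < edist_to (boundary Omega) x := lt_trans d0 dx.
  have Gs := pushG _ _ _ t01 dx0 (edist_eball_sub Ox (lexx _)).
  split; first by apply: Gs; exact: eball_center.
  exact: lt_le_trans dx (eball_sub_edist oO bO Gs).
- move=> x Ox; rewrite /G/= mul1r.
  suff [s ds Gs] : exists2 s, delta < s & eball (x + T *: V x) s `<=` Omega.
    split; first by apply: Gs; apply: eball_center; exact: lt_trans ds.
    exact: lt_le_trans ds (eball_sub_edist oO bO Gs).
  (* Far from the boundary the push may gain nothing, but it loses nothing and
     r / 8 > delta; near the boundary it gains c T = delta. *)
  have [far|/(edist_to_lt bO) near] := leP (r / 8) (edist_to (boundary Omega) x).
    exists (r / 8).
      by rewrite (lt_le_trans dlt)// ler_pdivrMr// ler_peMr//; lra.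
    by apply: (push _ _ _ (ltW T0) Tr _ (edist_eball_sub Ox far)).1; lra.
  have [s s0 xs] := open_eball oO Ox.
  exists (s + delta); first by rewrite ltrDr.
  by rewrite -[X in s + X]cT; exact: (push _ _ _ (ltW T0) Tr s0 xs).2.
Qed.
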